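(* Let $\Omega\subseteq\mathbb{R}^n$ be a smooth domain and let $T>0$. Assume that $f:[0,\infty)\to[0,\infty)$ is continuous and nondecreasing, and let $\phi\in L^1_+(\Omega)$. Then the operator $$\mathscr{F}[v](t)=S(t)\phi+\int_0^t S(t-s)f(v(s))\,\mathrm{d}s$$ admits a solution in $\Omega_T=\Omega\times(0,T)$ if and only if it admits a supersolution in $\Omega_T$.
   Context: $L^1_+(\Omega)$ is the set of a.e. nonnegative integrable functions on $\Omega$. $\{S(t)\}_{t\ge 0}$ is the Dirichlet heat semigroup on $\Omega$, $(S(t)\phi)(x)=\int_\Omega K(t,x,y)\phi(y)\,\mathrm{d}y$, where $K\ge 0$ is the (Dirichlet) heat kernel of $\Omega$; that is, $v(t)=S(t)\phi$ solves $v_t-\Delta v=0$ in $\Omega$, $v=0$ on $\partial\Omega$, $v(0)=\phi$. $\mathcal{M}_T^+$ denotes the set of nonnegative, almost everywhere finite, measurable functions on $\Omega_T=\Omega\times(0,T)$. A solution in $\Omega_T$ is any $u\in\mathcal{M}_T^+$ with $\mathscr{F}[u]=u$ a.e. in $\Omega_T$; a supersolution in $\Omega_T$ is any $w\in\mathcal{M}_T^+$ with $\mathscr{F}[w]\le w$ a.e. in $\Omega_T$. *)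

(* Defs.v *)
From HB Require Import structures.
From mathcomp Require Import all_boot all_order all_algebra.
From mathcomp Require Import all_classical all_reals all_analysis.
From mathcomp Require Import measurable_realfun lebesgue_integral_fubini.
Set Implicit Arguments.
Unset Strict Implicit.
Unset Printing Implicit Defensive.
Import Order.TTheory GRing.Theory Num.Theory.
Import numFieldNormedType.Exports.

Local Open Scope classical_set_scope.
Local Open Scope ring_scope.

Definition rV_display : measure_display.
Proof. exact: default_measure_display. Qed.

Section rV_measurable.
Context (R : realType) (n : nat).

Definition rV_coord (i : 'I_n) (x : 'rV[R]_n) : measurableTypeR R := x ord0 i.

(* The sigma-algebra generated by the coordinates: the Borel sets of R^n. *)
Definition rV_borel : set (set 'rV[R]_n) := g_sigma_preimage rV_coord.

Let rV_borel0 : rV_borel set0.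
Proof. exact: sigma_algebra0. Qed.

Let rV_borelC A : rV_borel A -> rV_borel (~` A).
Proof. exact: sigma_algebraC. Qed.

Let rV_borel_bigcup (F : (set 'rV[R]_n)^nat) :
  (forall i, rV_borel (F i)) -> rV_borel (\bigcup_i F i).
Proof. exact: sigma_algebra_bigcup. Qed.

HB.instance Definition _ := @isMeasurable.Build rV_display
  'rV[R]_n rV_borel rV_borel0 rV_borelC rV_borel_bigcup.

Lemma measurable_rV_coord (i : 'I_n) :
  measurable_fun [set: 'rV[R]_n] (rV_coord i).
Proof.
move=> _ Y mY; rewrite setTI; apply: sub_sigma_algebra => /=.
rewrite -bigcup_seq/=; exists i => /=; first by rewrite mem_index_enum.
by exists Y => //; rewrite setTI.
Qed.

Lemma measurable_fun_rVP d (T : measurableType d) (f : T -> 'rV[R]_n) :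
  (forall i, measurable_fun [set: T] (rV_coord i \o f)) ->
  measurable_fun [set: T] f.
Proof.
move=> mf _ A mA; rewrite setTI.
suff : rV_borel `<=` [set B | measurable (f @^-1` B)] by exact.
apply: smallest_sub.
- split => /=.
  + by rewrite preimage_set0.
  + by move=> B /= mB; rewrite setTD preimage_setC; exact: measurableC.
  + by move=> F mF; rewrite preimage_bigcup; exact: bigcup_measurable.
- rewrite -bigcup_seq => B [i _] [Y mY <-] /=; rewrite setTI.
  by have := mf i measurableT Y mY; rewrite setTI.
Qed.

End rV_measurable.

Section lebesgue_rV.
Context (R : realType).

Definition rV_cons n (p : measurableTypeR R * 'rV[R]_n) : 'rV[R]_n.+1 :=
  row_mx (const_mx p.1 : 'rV[R]_1) p.2.

Definition rV_uncons n (x : 'rV[R]_n.+1) : measurableTypeR R * 'rV[R]_n :=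
  (x ord0 ord0, \row_j x ord0 (lift ord0 j)).

Lemma rV_coord_cons0 n (p : measurableTypeR R * 'rV[R]_n) :
  rV_cons p ord0 ord0 = p.1.
Proof.
rewrite /rV_cons (_ : ord0 = lshift n (ord0 : 'I_1)); last exact/val_inj.
by rewrite (@row_mxEl _ 1%N 1%N n) mxE.
Qed.

Lemma rV_coord_consS n (p : measurableTypeR R * 'rV[R]_n) (j : 'I_n) :
  rV_cons p ord0 (lift ord0 j) = p.2 ord0 j.
Proof.
rewrite /rV_cons (_ : lift ord0 j = rshift 1 j); last exact/val_inj.
by rewrite (@row_mxEr _ 1%N 1%N n).
Qed.

Lemma rV_consK n : cancel (@rV_cons n) (@rV_uncons n).
Proof.
move=> p; rewrite /rV_uncons rV_coord_cons0 [RHS]surjective_pairing.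
by congr pair; apply/rowP => j; rewrite mxE rV_coord_consS.
Qed.

Lemma measurable_rV_cons n : measurable_fun setT (@rV_cons n).
Proof.
apply: measurable_fun_rVP => i; case: (unliftP ord0 i) => [j|] ->.
- rewrite (_ : _ \o _ = rV_coord j \o snd).
    by apply: measurableT_comp => //; exact: measurable_rV_coord.
  by apply/funext => p; rewrite /= /rV_coord rV_coord_consS.
- rewrite (_ : _ \o _ = fst) //.
  by apply/funext => p; rewrite /= /rV_coord rV_coord_cons0.
Qed.

Lemma measurable_rV_uncons n : measurable_fun setT (@rV_uncons n).
Proof.
apply: measurable_fun_pair; first exact: (@measurable_rV_coord R n.+1 ord0).
apply: measurable_fun_rVP => j.
rewrite (_ : _ \o _ = rV_coord (lift ord0 j)).
  exact: measurable_rV_coord.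
by apply/funext => x; rewrite /= /rV_coord mxE.
Qed.

Section step.
Context n (mu : {sigma_finite_measure set 'rV[R]_n -> \bar R}).

Definition lebesgue_rV_step : set 'rV[R]_n.+1 -> \bar R :=
  pushforward (@lebesgue_measure R \x mu)%E (@rV_cons n).

Let step0 : lebesgue_rV_step set0 = 0%E.
Proof. by rewrite /lebesgue_rV_step /pushforward preimage_set0 measure0. Qed.

Let step_ge0 A : (0 <= lebesgue_rV_step A)%E.
Proof. by rewrite /lebesgue_rV_step /pushforward; apply: measure_ge0. Qed.

Let measurable_preimage_cons A :
  measurable A -> measurable (@rV_cons n @^-1` A).
Proof. by rewrite -[X in _ -> measurable X]setTI; exact: measurable_rV_cons. Qed.

Let step_sigma_additive : semi_sigma_additive lebesgue_rV_step.
Proof.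
move=> F mF tF mUF; rewrite /lebesgue_rV_step /pushforward preimage_bigcup.
apply: measure_semi_sigma_additive.
- by move=> k; exact: measurable_preimage_cons.
- apply/trivIsetP => /= i j _ _ ij; rewrite -preimage_setI.
  by move/trivIsetP : tF => /(_ _ _ _ _ ij) ->//; rewrite preimage_set0.
- by rewrite -preimage_bigcup; exact: measurable_preimage_cons.
Qed.

HB.instance Definition _ := isMeasure.Build _ _ _ lebesgue_rV_step
  step0 step_ge0 step_sigma_additive.

Let step_sigma_finite : sigma_finite setT lebesgue_rV_step.
Proof.
have /sigma_finiteP[F [TF ndF Foo]] := sigma_finiteT (@lebesgue_measure R).
have /sigma_finiteP[G [TG ndG Goo]] := sigma_finiteT mu.
exists (fun k => @rV_uncons n @^-1` (F k `*` G k)).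
  rewrite -preimage_bigcup (_ : \bigcup_i _ = setT) ?preimage_setT//.
  rewrite -setXTT TF TG predeqE => -[x y]; split.
    by move=> [k _ []/= ? ?]; split; exists k.
  move=> [/= [k _ Fkx] [l _ Gly]]; exists (maxn k l) => //; split.
  - by move: x Fkx; exact/subsetPset/ndF/leq_maxl.
  - by move: y Gly; exact/subsetPset/ndG/leq_maxr.
move=> k; have [mF Fkoo] := Foo k; have [mG Gkoo] := Goo k; split.
  rewrite -[X in measurable X]setTI; apply: measurable_rV_uncons => //.
  exact: measurableX.
rewrite /lebesgue_rV_step /pushforward -comp_preimage.
rewrite (_ : _ \o _ = idfun); last by apply/funext => p /=; rewrite rV_consK.
by rewrite preimage_id product_measure1E// lte_mul_pinfty// ge0_fin_numE.
Qed.

HB.instance Definition _ := Measure_isSigmaFinite.Build _ _ _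
  lebesgue_rV_step step_sigma_finite.

End step.

Fixpoint lebesgue_rV n : {sigma_finite_measure set 'rV[R]_n -> \bar R} :=
  match n with
  | 0 => @dirac _ 'rV[R]_0 0 R
  | k.+1 => lebesgue_rV_step (lebesgue_rV k)
  end.

Lemma lebesgue_rV_box n (A : 'I_n -> set (measurableTypeR R)) :
  (forall i, measurable (A i)) ->
  lebesgue_rV n [set x | forall i, A i (x ord0 i)] =
  (\prod_(i < n) @lebesgue_measure R (A i))%E.
Proof.
elim: n A => [|n ih] A mA /=.
  rewrite big_ord0 diracE mem_set//; by case.
rewrite big_ord_recl /= -ih// /lebesgue_rV_step /pushforward.
rewrite (_ : _ @^-1` _ = A ord0 `*`
    [set x : 'rV[R]_n | forall i, A (lift ord0 i) (x ord0 i)]); last first.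
  apply/seteqP; split => [p /= Ap|p /= [A0 Ap] i].
    split; first by have := Ap ord0; rewrite rV_coord_cons0.
    by move=> i; have := Ap (lift ord0 i); rewrite rV_coord_consS.
  by case: (unliftP ord0 i) => [j|] ->;
    rewrite ?rV_coord_cons0 ?rV_coord_consS.
rewrite product_measure1E//.
rewrite (_ : mkset _ =
    \bigcap_(i in [set: 'I_n]) (@rV_coord R n i @^-1` A (lift ord0 i))).
  apply: fin_bigcap_measurable => // i _.
  by rewrite -[X in measurable X]setTI; exact: measurable_rV_coord.
by apply/seteqP; split => [x Ax i _|x Ax i]; [exact: Ax|exact: (Ax i)].
Qed.

End lebesgue_rV.

Section smooth_domain.
Context (R : realType) (n : nat).
Implicit Types (g : 'rV[R]_n -> R) (U Omega : set 'rV[R]_n).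

Definition unit_rV (i : 'I_n) : 'rV[R]_n := delta_mx ord0 i.

Definition partial (i : 'I_n) g : 'rV[R]_n -> R :=
  fun x => 'D_(unit_rV i) g x.

Definition laplacian g (x : 'rV[R]_n) : R :=
  \sum_(i < n) partial i (partial i g) x.

Definition smooth_on U g := forall (s : seq 'I_n) x, U x ->
  {for x, continuous (foldr partial g s)} /\
  forall i, derivable (foldr partial g s) x (unit_rV i).

Definition boundary U : set 'rV[R]_n := closure U `\` interior U.

(* [rho] is a local defining function: near [p], Omega is the side
   [rho < 0] of the smooth hypersurface [rho = 0] *)
Definition smooth_boundary Omega := forall p, boundary Omega p ->
  exists U rho, [/\ open U, U p, smooth_on U rho,
    exists i, partial i rho p != 0 &
    Omega `&` U = [set x | U x /\ rho x < 0]].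

Definition smooth_domain Omega :=
  [/\ open Omega, connected Omega, Omega !=set0 & smooth_boundary Omega].

End smooth_domain.

Section dirichlet_heat_kernel.
Context (R : realType) (n : nat).
Variable Omega : set 'rV[R]_n.

Record C21 (v : 'rV[R]_n -> R -> R) : Prop := {
  C21_dt : forall x (t : R), Omega x -> 0 < t -> derivable (v x) t 1;
  C21_dx : forall x (t : R) i, Omega x -> 0 < t ->
    derivable (v^~ t) x (unit_rV R i);
  C21_dxx : forall x (t : R) i j, Omega x -> 0 < t ->
    derivable (partial i (v^~ t)) x (unit_rV R j);
  C21_cont_dt : forall x (t : R), Omega x -> 0 < t ->
    {for (x, t), continuous (fun z : 'rV[R]_n * R => derive1 (v z.1) z.2)};
  C21_cont_dx : forall x (t : R) i, Omega x -> 0 < t ->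
    {for (x, t), continuous
      (fun z : 'rV[R]_n * R => partial i (v^~ z.2) z.1)};
  C21_cont_dxx : forall x (t : R) i j, Omega x -> 0 < t ->
    {for (x, t), continuous
      (fun z : 'rV[R]_n * R => partial j (partial i (v^~ z.2)) z.1)} }.

(* Boundedness matters only when Omega is unbounded, where it singles out a
   unique solution (Tychonoff). *)
Record dirichlet_heat_solution (phi : 'rV[R]_n -> R)
    (v : 'rV[R]_n -> R -> R) : Prop := {
  heat_C21 : C21 v;
  heat_cont : {within closure Omega `*` `[0, +oo[,
    continuous (fun z : 'rV[R]_n * R => v z.1 z.2)};
  heat_bounded : exists M, forall x (t : R), Omega x -> 0 < t -> `|v x t| <= M;
  heat_eq : forall x (t : R), Omega x -> 0 < t ->
    derive1 (v x) t = laplacian (v^~ t) x;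
  heat_boundary : forall x (t : R), boundary Omega x -> 0 <= t -> v x t = 0;
  heat_initial : forall x, Omega x -> v x 0 = phi x }.

Definition Cc (phi : 'rV[R]_n -> R) := continuous phi /\
  exists A, [/\ compact A, A `<=` Omega & forall x, ~ A x -> phi x = 0].

Variable K : R -> 'rV[R]_n -> 'rV[R]_n -> R.

Definition heat_semigroup (t : R) (phi : 'rV[R]_n -> R) (x : 'rV[R]_n) :
    \bar R :=
  \int[lebesgue_rV R n]_(y in Omega) (K t x y * phi y)%:E.

(* These conditions determine K on (0,oo) x Omega x Omega: test functions
   phi in C_c(Omega) determine K(t,x,.) a.e., hence everywhere by continuity. *)
Record dirichlet_heat_kernel : Prop := {
  kernel_ge0 : forall t x y, 0 < t -> Omega x -> Omega y -> 0 <= K t x y;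
  kernel_cont : forall t x y, 0 < t -> Omega x -> Omega y ->
    {for (t, x, y), continuous
      (fun z : R * 'rV[R]_n * 'rV[R]_n => K z.1.1 z.1.2 z.2)};
  kernel_heat : forall phi, Cc phi ->
    exists2 v, dirichlet_heat_solution phi v &
      forall t x, 0 < t -> Omega x -> heat_semigroup t phi x = (v x t)%:E }.

Definition L1plus (phi : 'rV[R]_n -> R) :=
  (lebesgue_rV R n).-integrable Omega (EFin \o phi) /\
  {ae lebesgue_rV R n, forall x, Omega x -> 0 <= phi x}.

Definition cylinder (T : R) : set ('rV[R]_n * R) := Omega `*` `]0, T[.

Definition ae_cylinder (T : R) (P : 'rV[R]_n * R -> Prop) :=
  {ae (lebesgue_rV R n \x @lebesgue_measure R)%E,
    forall z, cylinder T z -> P z}.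

Definition Mplus (T : R) (v : 'rV[R]_n * R -> \bar R) :=
  [/\ measurable_fun (cylinder T) v,
      forall z, cylinder T z -> (0 <= v z)%E &
      ae_cylinder T (fun z => v z \is a fin_num)].

Variables (f : R -> R) (phi : 'rV[R]_n -> R).

(* [f] acts on finite values only; [fine] sends +oo to 0, which for v in Mplus
   affects a null set and hence not the integral. *)
Definition duhamel (v : 'rV[R]_n * R -> \bar R) (z : 'rV[R]_n * R) : \bar R :=
  (heat_semigroup z.2 phi z.1 +
   \int[@lebesgue_measure R]_(s in `]0%R, z.2[)
     heat_semigroup (z.2 - s)%R (fun y => f (fine (v (y, s)))) z.1)%E.

Definition solution (T : R) (u : 'rV[R]_n * R -> \bar R) :=
  Mplus T u /\ ae_cylinder T (fun z => duhamel u z = u z).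

Definition supersolution (T : R) (w : 'rV[R]_n * R -> \bar R) :=
  Mplus T w /\ ae_cylinder T (fun z => (duhamel w z <= w z)%E).

End dirichlet_heat_kernel.

(* Main.v *)
(* The iterates u_0 = 0, u_(k+1) = F[u_k] are nondecreasing in k because the
   heat kernel is nonnegative and f is nondecreasing, and they stay below any
   supersolution w almost everywhere. Their supremum u is thus finite a.e., and
   monotone convergence together with the continuity of f gives F[u] = u. To have
   the iteration hold at every point, f is extended to +oo by its supremum; by
   Tonelli, F is then a nonlinear integral operator with one nonnegative
   measurable kernel on space-time, and agrees with the Duhamel operator on
   functions that are finite a.e. The kernel is measurable since it is
   continuous on an open set, hence a pointwise limit of its compositions with
   roundings to finer and finer grids. *)
Require Import Defs.
From HB Require Import structures.
From mathcomp Require Import all_boot all_order all_algebra.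
From mathcomp Require Import all_classical all_reals all_analysis.
From mathcomp Require Import measurable_realfun lebesgue_integral_fubini.
Set Implicit Arguments.
Unset Strict Implicit.
Unset Printing Implicit Defensive.
Import Order.TTheory GRing.Theory Num.Theory.
Import numFieldNormedType.Exports.
Local Open Scope classical_set_scope.
Local Open Scope ring_scope.

(** * Extension of a monotone function to the extended half-line *)

Section monotone_extension.
Context {R : realType} (g : R -> R).
Hypothesis g_ge0 : forall r, 0 <= g r.
Hypothesis g_nd : {homo g : r s / r <= s}.
Hypothesis g_cont : continuous g.
Local Open Scope ereal_scope.

(* The value at [+oo] makes this continuous along nondecreasing sequences of
   nonnegative extended reals (but [-oo] gets the junk value [g 0]). *)
Definition mono_ext (v : \bar R) : \bar R :=
  if v == +oo then ereal_sup (range (EFin \o g)) else (g (fine v))%:E.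

Lemma mono_ext_fin v : v \is a fin_num -> mono_ext v = (g (fine v))%:E.
Proof. by rewrite /mono_ext; case: v. Qed.

Lemma mono_ext_le_pinfty v : mono_ext v <= mono_ext +oo.
Proof.
rewrite /mono_ext eqxx; case: ifP => // _.
by apply: ereal_sup_ubound; exists (fine v).
Qed.

Lemma mono_ext_ge0 v : 0 <= mono_ext v.
Proof.
have h0 (r : R) : 0 <= mono_ext r%:E by rewrite mono_ext_fin// lee_fin.
case: v => [r| |]; first exact: h0.
- exact: le_trans (h0 0%R) (mono_ext_le_pinfty _).
- by rewrite /mono_ext/= lee_fin.
Qed.

(** Nonnegativity excludes [-oo], whose value [g 0] could break monotonicity. *)
Lemma le_mono_ext v w : 0 <= v -> v <= w -> mono_ext v <= mono_ext w.
Proof.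
case: w => [s| |] v0 vw; last by have := le_trans v0 vw.
- have vfin : v \is a fin_num by rewrite ge0_fin_numE// (le_lt_trans vw)// ltry.
  by rewrite !mono_ext_fin// lee_fin; apply/g_nd; rewrite -lee_fin fineK.
- exact: mono_ext_le_pinfty.
Qed.

Lemma measurable_mono_ext : measurable_fun setT mono_ext.
Proof.
apply: measurable_fun_ifT => //=.
  apply: (measurable_fun_bool true).
  rewrite setTI (_ : _ @^-1` _ = [set +oo]) //.
  by apply/seteqP; split => x /= /eqP.
apply/measurable_EFinP; apply: measurableT_comp => //.
exact: nondecreasing_measurable.
Qed.

(** If the supremum is finite, all terms are finite and continuity of [g] applies. If it is [+oo],
    the terms eventually exceed every real, so their images have the same supremum as the range of
    [g]. *)
Lemma cvg_mono_ext (u : (\bar R)^nat) : nondecreasing_seq u ->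
  (forall n, 0 <= u n) ->
  mono_ext (u n) @[n --> \oo] --> mono_ext (ereal_sup (range u)).
Proof.
move=> und u0; have ucvg := ereal_nondecreasing_cvgn und.
set L := ereal_sup (range u) in ucvg *.
have uL n : u n <= L by apply: ereal_sup_ubound; exists n.
case: (L =P +oo) => [Loo|/eqP Lnoo].
  have hnd : nondecreasing_seq (mono_ext \o u).
    by move=> m n mn; apply: le_mono_ext => //; exact: und.
  have -> : mono_ext L = ereal_sup (range (mono_ext \o u)).
    apply/eqP; rewrite eq_le; apply/andP; split; last first.
      apply: ge_ereal_sup => _ [n _ <-] /=; rewrite Loo.
      exact: mono_ext_le_pinfty.
    rewrite {1}/mono_ext Loo eqxx; apply: ge_ereal_sup => _ [r _ <-] /=.
    (* Clamping [r] at 0 keeps the comparison with [u n] among nonnegative values, where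
       [le_mono_ext] applies. *)
    have : (Num.max r 0)%:E < L by rewrite Loo ltry.
    move=> /ereal_sup_gt[_ [n _ <-]] run.
    apply: (@le_trans _ _ (mono_ext (Num.max r 0)%:E)).
      by rewrite mono_ext_fin// lee_fin; apply/g_nd; rewrite /= le_max lexx.
    apply: (@le_trans _ _ (mono_ext (u n))).
      by apply: le_mono_ext (ltW run) => //; rewrite lee_fin le_max lexx orbT.
    by apply: ereal_sup_ubound; exists n.
  exact: ereal_nondecreasing_cvgn.
have Lfin : L \is a fin_num by rewrite ge0_fin_numE ?ltey// (le_trans (u0 0%N)).
have ufin n : u n \is a fin_num.
  by rewrite ge0_fin_numE// (le_lt_trans (uL n))// ltey.
rewrite (mono_ext_fin Lfin) (_ : (fun n => _) = EFin \o (g \o (fine \o u))).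
  apply: cvg_EFin; first exact: nearW.
  apply: continuous_cvg; first exact: g_cont.
  by apply: fine_cvg; rewrite fineK.
by apply/funext => n /=; rewrite mono_ext_fin.
Qed.

End monotone_extension.

(** * Monotone iteration for a nonlinear integral operator *)

Section integral_fixpoint.
Local Open Scope ereal_scope.
Context d (Z : measurableType d) (R : realType).
Variable mu : {sigma_finite_measure set Z -> \bar R}.
Variables (k : Z * Z -> R) (a : Z -> \bar R) (h : \bar R -> \bar R).
Hypothesis k_ge0 : forall z, (0 <= k z)%R.
Hypothesis mk : measurable_fun setT k.
Hypothesis a_ge0 : forall z, 0 <= a z.
Hypothesis ma : measurable_fun setT a.
Hypothesis h_ge0 : forall v, 0 <= h v.
Hypothesis mh : measurable_fun setT h.
Hypothesis h_nd : forall v w, 0 <= v -> v <= w -> h v <= h w.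
Hypothesis h_cvg : forall u : (\bar R)^nat, nondecreasing_seq u ->
  (forall n, 0 <= u n) -> h (u n) @[n --> \oo] --> h (ereal_sup (range u)).

(** A Hammerstein operator with forcing term [a]: a linear integral operator applied after the
    pointwise nonlinearity [h]. *)
Definition integral_op (v : Z -> \bar R) (z : Z) : \bar R :=
  a z + \int[mu]_z' ((k (z, z'))%:E * h (v z')).

Let mintegrand v z : measurable_fun setT v ->
  measurable_fun setT (fun z' => (k (z, z'))%:E * h (v z')).
Proof.
move=> mv; apply: emeasurable_funM; last exact: measurableT_comp.
apply/measurable_EFinP; apply: measurableT_comp => //.
Qed.

Let integrand_ge0 v z z' : 0 <= (k (z, z'))%:E * h (v z').
Proof. by rewrite mule_ge0// lee_fin. Qed.

Lemma integral_op_ge0 v z : 0 <= integral_op v z.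
Proof. by rewrite adde_ge0// integral_ge0. Qed.

Lemma measurable_integral_op v :
  measurable_fun setT v -> measurable_fun setT (integral_op v).
Proof.
move=> mv; apply: emeasurable_funD => //.
apply: (@measurable_fun_fubini_tonelli_F _ _ _ _ _ mu
  (fun p => (k p)%:E * h (v p.2))).
  apply: emeasurable_funM; first exact/measurable_EFinP.
  by do 2 apply: measurableT_comp => //.
by move=> p; rewrite mule_ge0// lee_fin.
Qed.

(** The operator sees [v] and [w] only under the integral, so null sets drop out: an inequality a.e.
    becomes one at every [z]. *)
Lemma ae_le_integral_op v w z :
  measurable_fun setT v -> measurable_fun setT w ->
  (forall z, 0 <= v z) -> {ae mu, forall z, v z <= w z} ->
  integral_op v z <= integral_op w z.
Proof.
move=> mv mw v0 vw; rewrite leeD2l//; apply: ae_ge0_le_integral => //.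
- exact: mintegrand.
- exact: mintegrand.
- apply: filterS vw => z' vwz _.
  apply: lee_pmul => //; first by rewrite lee_fin.
  exact: h_nd.
Qed.

Let it n : Z -> \bar R := iter n integral_op (cst 0).

Let mit n : measurable_fun setT (it n).
Proof. by elim: n => [|n ih] //=; exact: measurable_integral_op. Qed.

Let it_ge0 n z : 0 <= it n z.
Proof. by case: n => [|n] //=; exact: integral_op_ge0. Qed.

Let it_nd z : nondecreasing_seq (it^~ z).
Proof.
apply/nondecreasing_seqP => n; elim: n z => [|n ih] z.
  exact: integral_op_ge0.
exact: (ae_le_integral_op z (mit n) (mit n.+1) (it_ge0 n) (aeW mu ih)).
Qed.

Lemma integral_op_fixpoint w : measurable_fun setT w ->
  {ae mu, forall z, integral_op w z <= w z} -> (forall z, 0 <= w z) ->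
  exists u, [/\ measurable_fun setT u, forall z, 0 <= u z,
    forall z, integral_op u z = u z & {ae mu, forall z, u z <= w z}].
Proof.
move=> mw Gw w0; exists (fun z => ereal_sup (range (it^~ z))).
have cvgu z := ereal_nondecreasing_cvgn (it_nd z).
(* By [ae_le_integral_op], the induction step excludes no null set beyond that of [Gw]. *)
have itw n : {ae mu, forall z, it n z <= w z}.
  elim: n => [|n ih]; first exact: (aeW mu).
  by apply: filterS Gw => z; apply: le_trans; exact: ae_le_integral_op.
split.
- by apply: (emeasurable_fun_cvg it) => // z _; exact: cvgu.
- move=> z; apply: le_trans (it_ge0 0%N z) _.
  by apply: ereal_sup_ubound; exists 0%N.
- move=> z.
  (* [h] commutes with the increasing limit, and monotone convergence carries this through the
     integral. *)
  have cvgGu : integral_op (it n) z @[n --> \oo] -->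
      integral_op (fun z => ereal_sup (range (it^~ z))) z.
    have integrand_cvg z' : (k (z, z'))%:E * h (it n z') @[n --> \oo] -->
        (k (z, z'))%:E * h (ereal_sup (range (it^~ z'))).
      by apply: cvgeZl => //; apply: h_cvg => //; exact: it_nd.
    apply: cvgeD; [|exact: cvg_cst|].
      rewrite ge0_adde_def// inE//; apply: integral_ge0 => z' _.
      by rewrite mule_ge0// lee_fin.
    have <- : \int[mu]_z' limn (fun n => (k (z, z'))%:E * h (it n z')) =
        \int[mu]_z' ((k (z, z'))%:E * h (ereal_sup (range (it^~ z')))).
      by apply: eq_integral => z' _; exact/cvg_lim.
    apply: cvg_monotone_convergence => //.
    + by move=> n; exact: mintegrand.
    + move=> z' _ m n mn; rewrite lee_pmul//; first by rewrite lee_fin.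
      by apply: h_nd => //; exact: it_nd.
  (* [integral_op (it n)] is [it n.+1], so the limit just found is also that of the shifted sequence
     of iterates. *)
  have /(cvg_lim (@ereal_hausdorff R)) <- := cvgGu.
  by apply: cvg_lim; rewrite ?(cvg_shiftS (it^~ z)).
- have : {ae mu, forall z, forall n, it n z <= w z} by exact/ae_foralln.
  by apply: filterS => z uw; apply: ge_ereal_sup => _ [n _ <-].
Qed.

End integral_fixpoint.

(** * Grid rounding and Borel measurability *)

(* Rounding to a grid of mesh [1 / (k + 1)] factors through a countable type, so
   composing it with any function gives a measurable function. *)
Lemma measurable_preimage_countType d (T : measurableType d) (C : countType)
    (q : T -> C) :
  (forall c, measurable (q @^-1` [set c])) -> forall B, measurable (q @^-1` B).
Proof.
move=> mq B; rewrite (_ : _ @^-1` B = \bigcup_(c in [set: C])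
    (if c \in B then q @^-1` [set c] else set0)).
  apply: countable_bigcupT_measurable; first exact: countableP.
  by move=> c; case: ifP.
apply/seteqP; split => [x Bqx|x [c _]]; last first.
  by case: ifPn => // /set_mem Bc qx; rewrite /preimage/= qx.
by exists (q x) => //; rewrite mem_set.
Qed.

Section grid.
Context {R : realType} (n : nat).

Definition grid k (c : R) : int := Num.floor (k.+1%:R * c).
Definition gridpt k (m : int) : R := k.+1%:R^-1 * m%:~R.

Lemma gridptK k c : `|c - gridpt k (grid k c)| < k.+1%:R^-1.
Proof.
have k0 : 0 < k.+1%:R :> R by rewrite ltr0n.
rewrite -{1}[c](mulKf (lt0r_neq0 k0)) -mulrBr normrM ger0_norm ?invr_ge0 ?ltW//.
rewrite gtr_pMr ?invr_gt0// ger0_norm ?subr_ge0 ?floor_le// ltrBlDl.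
by have := floorD1_gt (k.+1%:R * c); rewrite intrD.
Qed.

Lemma measurable_grid k m : measurable (grid k @^-1` [set m]).
Proof.
have mul_m : measurable_fun setT (fun c : R => k.+1%:R * c).
  exact: mulrl_measurable.
rewrite (_ : _ @^-1` _ =
    (fun c : R => k.+1%:R * c) @^-1` `[m%:~R, (m + 1)%:~R[).
  by rewrite -[X in measurable X]setTI; exact: mul_m.
apply/seteqP; split => c; rewrite /grid /= in_itv/=; last exact: floor_def.
by move=> <-; rewrite floor_le floorD1_gt.
Qed.

Definition rV_grid k (x : 'rV[R]_n) : 'rV[int]_n := map_mx (grid k) x.
Definition rV_gridpt k (m : 'rV[int]_n) : 'rV[R]_n := map_mx (gridpt k) m.

Lemma measurable_rV_grid k m : measurable (rV_grid k @^-1` [set m]).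
Proof.
rewrite (_ : _ @^-1` _ =
    \bigcap_(i in [set: 'I_n])
      (@rV_coord R n i @^-1` (grid k @^-1` [set m ord0 i]))).
  apply: fin_bigcap_measurable => // i _.
  rewrite -[X in measurable X]setTI; apply: measurable_rV_coord => //.
  exact: measurable_grid.
apply/seteqP; split => [x /= <- i _|x xm]; first by rewrite /= mxE.
by apply/rowP => i; rewrite mxE; exact: xm.
Qed.

Lemma ball_rV_gridptK k x e : 0 < e -> k.+1%:R^-1 <= e ->
  ball x e (rV_gridpt k (rV_grid k x)).
Proof.
move=> e0 ke; split => // i j; rewrite !mxE ord1.
exact: lt_le_trans (gridptK _ _) _.
Qed.

Lemma cvg_gridpt (c : R) : gridpt k (grid k c) @[k --> \oo] --> c.
Proof.
apply/cvg_ballP => e e0; near=> k; rewrite /ball/=.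
apply: lt_trans (gridptK _ _) _.
near: k; exact: near_infty_natSinv_lt (PosNum e0).
Unshelve. all: by end_near. Qed.

Lemma cvg_rV_gridpt (x : 'rV[R]_n) :
  rV_gridpt k (rV_grid k x) @[k --> \oo] --> x.
Proof.
apply/cvg_ballP => e e0; near=> k.
apply: ball_rV_gridptK => //; apply: ltW.
near: k; exact: near_infty_natSinv_lt (PosNum e0).
Unshelve. all: by end_near. Qed.

(** The sigma-algebra is generated by coordinates, so open sets must be linked to it: each point of
    [U] has a fine enough grid cell inside [U], and [U] is the countable union of the cells it
    contains. *)
Lemma open_measurable_rV (U : set 'rV[R]_n) : open U -> measurable U.
Proof.
move=> oU.
rewrite (_ : U = \bigcup_k
    (rV_grid k @^-1` [set m | rV_grid k @^-1` [set m] `<=` U])).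
  apply: bigcupT_measurable => k.
  apply: measurable_preimage_countType; exact: measurable_rV_grid.
apply/seteqP; split => [x Ux|x [k _]]; last exact.
have /nbhs_ballP[e /= e0 xeU] : nbhs x U by exact: open_nbhs_nbhs.
have e20 : 0 < e / 2 by rewrite divr_gt0.
have [k ke] : exists k, k.+1%:R^-1 < e / 2.
  have : \forall k \near \oo, (k.+1%:R^-1 : R) < e / 2.
    exact: (near_infty_natSinv_lt (PosNum e20)).
  by move=> [k _ kk]; exists k; apply: kk; rewrite /=.
exists k => // y /= yx; apply: xeU.
(* Points of one cell lie within [e / 2] of their common grid point. *)
apply: (@ball_split _ _ (rV_gridpt k (rV_grid k x))).
  exact: ball_rV_gridptK (ltW ke).
by apply: ball_sym; rewrite -yx; exact: ball_rV_gridptK (ltW ke).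
Qed.

(** Each [F \o p k \o q k] is measurable because [q k] has countably many values. Continuity is
    meant in the whole space, so these converge to [F] on [D] even if rounded points leave [D]. *)
Lemma continuous_measurable_triple (D : set (R * 'rV[R]_n * 'rV[R]_n))
    (F : R * 'rV[R]_n * 'rV[R]_n -> R) :
  (forall z, D z -> {for z, continuous F}) -> measurable_fun D F.
Proof.
move=> Fcont.
pose q k (z : R * 'rV[R]_n * 'rV[R]_n) :=
  (grid k z.1.1, rV_grid k z.1.2, rV_grid k z.2).
pose p k (c : int * 'rV[int]_n * 'rV[int]_n) :=
  (gridpt k c.1.1, rV_gridpt k c.1.2, rV_gridpt k c.2).
apply: (@measurable_fun_cvg _ _ _ _ (fun k => F \o p k \o q k)).
  move=> k mD Y mY; apply: measurableI => //; rewrite comp_preimage.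
  apply: measurable_preimage_countType => -[[a b] c].
  rewrite (_ : _ @^-1` _ =
      (grid k @^-1` [set a] `*` (rV_grid k @^-1` [set b])) `*`
      (rV_grid k @^-1` [set c])).
    apply: measurableX; last exact: measurable_rV_grid.
    by apply: measurableX; [exact: measurable_grid|exact: measurable_rV_grid].
  apply/seteqP; split => -[[t x] y] /=; rewrite /q/=.
    by case=> <- <- <-.
  by case=> -[-> ->] ->.
move=> z /Fcont; move: z => [[t x] y] Fz.
apply: (@continuous_cvg _ _ _ _ _ (fun k => p k (q k (t, x, y))) F) => //.
apply: (@cvg_pair _ _ _ _ (nbhs (t, x)) (nbhs y)).
  apply: (@cvg_pair _ _ _ _ (nbhs t) (nbhs x)).
    exact: cvg_gridpt.
  exact: cvg_rV_gridpt.
exact: cvg_rV_gridpt.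
Qed.

End grid.

(** * Space-time product measure and extension of [f] to the line *)

Section product_sigma_finite.
Context d1 d2 (T1 : measurableType d1) (T2 : measurableType d2) {R : realType}.
Variables (m1 : {sigma_finite_measure set T1 -> \bar R})
          (m2 : {sigma_finite_measure set T2 -> \bar R}).

(* A copy of [m1 \x m2]: on the library constant itself, a canonical structure
   for subprobabilities shadows the sigma-finite one. *)
Definition sfproduct : set (T1 * T2) -> \bar R := (m1 \x m2)%E.

HB.instance Definition _ := Measure.on sfproduct.

Let sfproduct_sigma_finite : sigma_finite setT sfproduct.
Proof.
by case:
  (measure_function_Measure_isSigmaFinite__to__measure_function_isSigmaFinite
    m1 m2).
Qed.

HB.instance Definition _ := Measure_isSigmaFinite.Build _ _ _
  sfproduct sfproduct_sigma_finite.

End product_sigma_finite.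

(** Clamping retracts the line onto the half-line, so one-sided continuity at 0 becomes
    two-sided. *)
Lemma continuous_max0 {R : realType} (f : R -> R) :
  {within `[0, +oo[, continuous f} -> continuous (fun r : R => f (Num.max r 0)).
Proof.
move=> /subspace_continuousP fc r.
have r0 : `[0, +oo[%classic (Num.max r 0).
  by rewrite /= in_itv/= le_max lexx orbT.
apply: cvg_trans (fc _ r0); move=> P; rewrite /within/= => nP.
have maxc : {for r, continuous (fun r : R => Num.max r 0)}.
  by apply: continuous_max; [exact: cvg_id|exact: cvg_cst].
suff : \forall s \near r, P (f (Num.max s 0)) by [].
near=> s.
have : `[0, +oo[%classic (Num.max s 0) -> P (f (Num.max s 0)).
  by near: s; exact: (maxc _ nP).
by apply; rewrite /= in_itv/= le_max lexx orbT.
Unshelve. all: by end_near. Qed.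

(** * The Duhamel operator as a space-time integral operator *)

Section duhamel.
Local Open Scope ereal_scope.
Context {R : realType} (n : nat) (Omega : set 'rV[R]_n).
Variables (K : R -> 'rV[R]_n -> 'rV[R]_n -> R) (T : R).
Variables (f : R -> R) (phi : 'rV[R]_n -> R).
Hypothesis oOmega : open Omega.
Hypothesis kernelK : dirichlet_heat_kernel Omega K.
Hypothesis f_ge0 : forall r, (0 <= r -> 0 <= f r)%R.
Hypothesis f_cont : {within `[0%R, +oo[, continuous f}.
Hypothesis f_nd : {in `[0%R, +oo[ &, {homo f : r s / (r <= s)%R}}.
Hypothesis phi_L1 : L1plus Omega phi.

Local Notation spacetime := ('rV[R]_n * measurableTypeR R)%type.
Local Notation mu := (sfproduct (lebesgue_rV R n) (@lebesgue_measure R)).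
Let Q := cylinder Omega T.
Let h := mono_ext (fun r : R => f (Num.max r 0%R)).

Let mOmega : measurable Omega. Proof. exact: open_measurable_rV. Qed.

Let mQ : measurable Q.
Proof. by apply: measurableX => //; exact: measurable_itv. Qed.

Definition kernel_dom : set (R * 'rV[R]_n * 'rV[R]_n) :=
  (`]0%R, +oo[%classic `*` Omega) `*` Omega.

(** Extension by zero gives a kernel that is nonnegative and measurable everywhere; its vanishing at
    times [t <= 0] encodes the upper limit of the Duhamel integral. *)
Definition kernel0 : R * 'rV[R]_n * 'rV[R]_n -> R :=
  (fun p => K p.1.1 p.1.2 p.2) \_ kernel_dom.

Lemma kernel0E t x y : (0 < t)%R -> Omega x -> Omega y ->
  kernel0 (t, x, y) = K t x y.
Proof.
by move=> t0 Ox Oy; rewrite /kernel0 patchE mem_set// /kernel_dom/= in_itv/= t0.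
Qed.

Lemma kernel0_eq0 t x y : ~ ((0 < t)%R /\ Omega y) -> kernel0 (t, x, y) = 0%R.
Proof.
move=> tO; rewrite /kernel0 patchE memNset// /kernel_dom/= in_itv/= andbT.
by move=> [[t0 _] Oy]; exact: tO.
Qed.

Lemma kernel0_ge0 p : (0 <= kernel0 p)%R.
Proof.
rewrite /kernel0 patchE; case: ifPn => // /set_mem[[/=]].
by rewrite in_itv/= andbT => t0 Ox Oy; exact: (kernel_ge0 kernelK).
Qed.

Lemma measurable_kernel0 : measurable_fun setT kernel0.
Proof.
apply/measurable_restrict => //.
  by apply: measurableX => //; apply: measurableX => //; exact: measurable_itv.
rewrite setTI; apply: continuous_measurable_triple => -[[t x] y] [[/=]].
by rewrite in_itv/= andbT => t0 Ox Oy; exact: (kernel_cont kernelK).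
Qed.

(* The absolute value changes [phi] on a null set only, and makes the integrand
   nonnegative everywhere. *)
Definition heat_part (z : 'rV[R]_n * R) : \bar R :=
  \int[lebesgue_rV R n]_y (kernel0 (z.2, z.1, y) * `|(phi \_ Omega) y|)%:E.

(** [kernel0] cuts off [s >= t] and the indicator cuts off [s <= 0], so the nested Duhamel integrals
    become one integral over all of space-time, blind to values outside [Q]. *)
Definition duhamel_kernel (p : ('rV[R]_n * R) * ('rV[R]_n * R)) : R :=
  (kernel0 (p.1.2 - p.2.2, p.1.1, p.2.1) * \1_Q p.2)%R.

Let mphi : measurable_fun Omega phi.
Proof. by apply/measurable_EFinP; case/integrableP : phi_L1.1. Qed.

Let mphi0 : measurable_fun setT (phi \_ Omega).
Proof. by apply/measurable_restrict => //; rewrite setTI. Qed.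

Lemma heat_part_ge0 z : 0 <= heat_part z.
Proof.
by apply: integral_ge0 => y _; rewrite lee_fin mulr_ge0// kernel0_ge0.
Qed.

Lemma measurable_heat_part : measurable_fun setT heat_part.
Proof.
apply: (@measurable_fun_fubini_tonelli_F _ _ _ _ _ (lebesgue_rV R n)
  (fun p => (kernel0 (p.1.2, p.1.1, p.2) * `|(phi \_ Omega) p.2|)%:E)).
  apply/measurable_EFinP; apply: measurable_funM.
    apply: (measurableT_comp measurable_kernel0) => /=.
    apply: measurable_fun_pair => //=; apply: measurable_fun_pair.
      by apply: measurableT_comp.
    by apply: measurableT_comp.
  apply: measurableT_comp => //; exact: (measurableT_comp mphi0).
by move=> p; rewrite lee_fin mulr_ge0// kernel0_ge0.
Qed.

Lemma duhamel_kernel_ge0 p : (0 <= duhamel_kernel p)%R.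
Proof. by rewrite mulr_ge0 ?kernel0_ge0// indicE. Qed.

Lemma measurable_duhamel_kernel : measurable_fun setT duhamel_kernel.
Proof.
apply: measurable_funM; last first.
  by apply: (measurableT_comp (measurable_indic mQ)) => //.
apply: (measurableT_comp measurable_kernel0) => /=.
apply: measurable_fun_pair => /=; last exact: measurableT_comp.
apply: measurable_fun_pair => /=; last exact: measurableT_comp.
by apply: measurable_funB; exact: measurableT_comp.
Qed.

Let g_ge0 r : (0 <= f (Num.max r 0%R))%R.
Proof. by apply: f_ge0; rewrite le_max lexx orbT. Qed.

Let g_nd : {homo (fun r : R => f (Num.max r 0%R)) : r s / (r <= s)%R}.
Proof.
move=> r s rs; apply: f_nd; last exact: le_max2.
- by rewrite in_itv/= le_max lexx orbT.
- by rewrite in_itv/= le_max lexx orbT.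
Qed.

Lemma heat_semigroupE z : Q z ->
  heat_semigroup Omega K z.2 phi z.1 = heat_part z.
Proof.
move: z => [x t] [/= Ox]; rewrite in_itv/= => /andP[t0 _].
rewrite /heat_part /heat_semigroup.
transitivity (\int[lebesgue_rV R n]_(y in Omega) (K t x y * `|phi y|)%:E);
  last first.
  rewrite integral_mkcond; apply: eq_integral => y _ /=.
  rewrite !patchE; case: ifPn => [/set_mem Oy|/negP Oy].
    by rewrite kernel0E.
  by rewrite normr0 mulr0.
have mK : measurable_fun Omega (K t x).
  apply: (eq_measurable_fun (fun y => kernel0 (t, x, y))).
    by move=> y /set_mem Oy; rewrite kernel0E.
  apply: measurable_funTS; apply: (measurableT_comp measurable_kernel0).
  exact: measurable_fun_pair.
apply: ae_eq_integral => //.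
- by apply/measurable_EFinP; exact: measurable_funM.
- apply/measurable_EFinP; apply: measurable_funM => //.
  exact: measurableT_comp.
- by apply: filterS phi_L1.2 => y phi0 Oy /=; rewrite ger0_norm ?phi0.
Qed.

(** Tonelli merges the integrals in [y] and [s], and [h] agrees with [f] off the null set where [v]
    is infinite. Since [v] enters only under integrals, equality holds at every point of [Q]. *)
Lemma duhamelE v v' z : Mplus Omega T v -> measurable_fun setT v' ->
  (forall z, Q z -> v' z = v z) -> Q z ->
  duhamel Omega K f phi v z = integral_op mu duhamel_kernel heat_part h v' z.
Proof.
move=> [mv v0 vfin] mv' v'v Qz; rewrite /duhamel /integral_op heat_semigroupE//.
congr (_ + _); move: z Qz => [x t] [/= Ox]; rewrite in_itv/= => /andP[t0 tT].
(* The real-valued integrand: [fine] reads [+oo] as 0, as in [duhamel], so [A] matches the nested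
   integrals exactly. *)
pose A (z' : 'rV[R]_n * R) :=
  (duhamel_kernel ((x, t), z') * f (Num.max (fine (v' z')) 0%R))%:E.
have mk : measurable_fun setT (fun z' => duhamel_kernel ((x, t), z')).
  apply: (measurableT_comp measurable_duhamel_kernel).
  exact: measurable_fun_pair.
have mA : measurable_fun setT A.
  apply/measurable_EFinP; apply: measurable_funM => //.
  apply: (@measurableT_comp _ _ _ _ _ _ (fun r : R => f (Num.max r 0%R))).
    exact: nondecreasing_measurable.
  exact: measurableT_comp.
have A0 z' : 0 <= A z' by rewrite lee_fin mulr_ge0// duhamel_kernel_ge0.
(* [A] and the integrand with [h] can differ only at points of [Q] where [v] is infinite. *)
transitivity (\int[mu]_z' A z'); last first.
  apply: ge0_ae_eq_integral => //.
  - apply: emeasurable_funM; first exact/measurable_EFinP.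
    by apply: measurableT_comp => //; exact: measurable_mono_ext.
  - move=> z' _.
    by rewrite mule_ge0 ?lee_fin ?duhamel_kernel_ge0// mono_ext_ge0.
  - have vfin' : {ae mu, forall z : spacetime,
        Q z -> v z \is a fin_num} := vfin.
    apply: filterS vfin' => z' vfinz _; rewrite /A EFinM.
    have [Qz'|Qz'] := pselect (Q z').
      by rewrite /h mono_ext_fin// v'v//; exact: vfinz.
    by rewrite /duhamel_kernel/= indicE memNset// mulr0 !mul0e.
transitivity (\int[@lebesgue_measure R]_s \int[lebesgue_rV R n]_y A (y, s)).
  rewrite integral_mkcond; apply: eq_integral => s _; rewrite patchE.
  case: ifPn => [/set_mem/=|/negP].
    rewrite in_itv/= => /andP[s0 st].
    rewrite /heat_semigroup integral_mkcond; apply: eq_integral => y _.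
    rewrite patchE /A /duhamel_kernel/=; case: ifPn => [/set_mem Oy|/negP Oy].
      have Qys : Q (y, s) by split => //=; rewrite in_itv/= s0 (lt_trans st).
      rewrite kernel0E ?subr_gt0// indicE mem_set// mulr1 v'v//.
      by rewrite (max_l _) ?fine_ge0 ?v0.
    by rewrite kernel0_eq0 ?mul0r// => -[_ Oy']; apply: Oy; rewrite inE.
  move=> st; rewrite integral0_eq// => y _; rewrite /A /duhamel_kernel/=.
  have [s0|s0] := leP s 0%R.
    rewrite indicE memNset ?mulr0 ?mul0r// => -[_] /=.
    by rewrite in_itv/= ltNge s0.
  rewrite kernel0_eq0 ?mul0r// => -[]; rewrite subr_gt0 => st' _.
  by apply: st; rewrite inE/= in_itv/= s0.
exact/esym/(@fubini_tonelli2 _ _ _ _ _ (lebesgue_rV R n)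
  (@lebesgue_measure R) A).
Qed.

Lemma supersolution_of_solution u : solution Omega K f phi T u ->
  supersolution Omega K f phi T u.
Proof.
move=> [Mu Fu]; split => //.
have {}Fu : {ae mu, forall z : spacetime, Q z ->
    duhamel Omega K f phi u z = u z} := Fu.
by apply: filterS Fu => z Fuz Qz; rewrite Fuz.
Qed.

(* Off the cylinder [w] is replaced by [+oo], which makes the supersolution
   inequality trivial there. *)
Lemma solution_of_supersolution w : supersolution Omega K f phi T w ->
  exists u, solution Omega K f phi T u.
Proof.
move=> [Mw Fw]; have [mw w0 wfin] := Mw.
have {}Fw : {ae mu, forall z : spacetime, Q z ->
    duhamel Omega K f phi w z <= w z} := Fw.
have {}wfin : {ae mu, forall z : spacetime,
    Q z -> w z \is a fin_num} := wfin.
pose w' z := if z \in Q then w z else +oo.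
have mw' : measurable_fun setT w'.
  apply: measurable_fun_if => //.
  - apply: (measurable_fun_bool true); rewrite setTI (_ : _ @^-1` _ = Q)//.
    by apply/seteqP; split => z; [exact: set_mem|exact: mem_set].
  - rewrite setTI (_ : _ @^-1` _ = Q)//.
    by apply/seteqP; split => z; [exact: set_mem|exact: mem_set].
have w'Q z : Q z -> w' z = w z by move=> Qz; rewrite /w' mem_set.
have [u [mu_u u0 Gu uw']] : exists u, [/\ measurable_fun setT u,
    forall z, 0 <= u z,
    forall z, integral_op mu duhamel_kernel heat_part h u z = u z &
    {ae mu, forall z, u z <= w' z}].
  apply: (@integral_op_fixpoint _ _ R mu duhamel_kernel heat_part h).
  - exact: duhamel_kernel_ge0.
  - exact: measurable_duhamel_kernel.
  - exact: heat_part_ge0.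
  - exact: measurable_heat_part.
  - by move=> v; exact: mono_ext_ge0.
  - exact: measurable_mono_ext.
  - by move=> v v'; exact: le_mono_ext.
  - by move=> v vnd v0; apply: cvg_mono_ext => //; exact: continuous_max0.
  - exact: mw'.
  (* On [Q] the operator at [w'] is the Duhamel operator at [w], unaffected by the value [+oo]
     outside. *)
  - apply: filterS Fw => z Fwz; have [Qz|Qz] := pselect (Q z).
      by rewrite -(duhamelE Mw)// w'Q//; exact: Fwz.
    by rewrite /w' memNset// leey.
  - by move=> z; rewrite /w'; case: ifPn => // /set_mem; exact: w0.
(* The a.e. bound by the a.e. finite [w] puts [u] in [Mplus], so that [duhamelE] applies to [u] as
   well. *)
have Mu : Mplus Omega T u.
  split => //; first exact: measurable_funTS.
  apply: filterS2 uw' wfin => z uw wfin Qz.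
  rewrite ge0_fin_numE// (le_lt_trans uw)// w'Q// -ge0_fin_numE ?w0//.
  exact: wfin.
exists u; split => //; apply: aeW => z Qz.
by rewrite (duhamelE Mu mu_u).
Qed.

End duhamel.

Theorem theorem2p1 (R : realType) (n : nat) (n_gt0 : (0 < n)%N)
    (Omega : set 'rV[R]_n) (K : R -> 'rV[R]_n -> 'rV[R]_n -> R)
    (T : R) (f : R -> R) (phi : 'rV[R]_n -> R) :
  smooth_domain Omega ->
  dirichlet_heat_kernel Omega K ->
  0 < T ->
  (forall r, 0 <= r -> 0 <= f r) ->
  {within `[0, +oo[, continuous f} ->
  {in `[0, +oo[ &, {homo f : r s / r <= s}} ->
  L1plus Omega phi ->
  (exists u, solution Omega K f phi T u) <->
  (exists w, supersolution Omega K f phi T w).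
Proof.
move=> [oOmega _ _ _] kernelK _ f_ge0 f_cont f_nd phi_L1; split.
- by move=> [u]; exists u; exact: supersolution_of_solution.
- by move=> [w]; exact: solution_of_supersolution.
Qed.
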